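(* Let $\delta\ge1$, $\left(1-\frac1\delta\right)\le\zeta\le\left(1-\frac1{2\delta}\right)$ and $\xi=1-\delta(1-\zeta)$, so that $0\le\xi\le1/2$. Let $\mu\in[1/2,1]$ and $\nu\ge1$, with $\mu\nu=\gamma$ and $\mu+\nu=\alpha-\gamma$. Let $\lambda:[0,1]\to\mathbb{R}$ be a non-negative integrable function with $\int_0^1\lambda(t)\,dt=1$, let $\beta<1$ satisfy $$\frac{\beta-\frac12}{1-\beta}=-\int_0^1\lambda(t)\,q_{\mu,\nu}^\delta(t)\,dt,$$ and suppose that the function $$\frac{t^{\frac1\mu(\delta-1)}\left(\delta\left(1-\frac1\mu\right)\Pi_{\mu,\nu}^\delta(t)-t\left(\Pi_{\mu,\nu}^\delta(t)\right)'\right)}{(\log(1/t))^{3-2\delta(1-\zeta)}}$$ is decreasing on $(0,1)$. Then $\mathcal{M}_{\Pi_{\mu,\nu}^\delta}(h_\xi)(z)\ge0$ for all $z\in\mathbb{D}$ and all $|\epsilon|=1$, where $$h_\xi(z)=z\,\frac{1+\frac{\epsilon+2\xi-1}{2(1-\xi)}z}{(1-z)^2},\qquad \mathcal{M}_{\Pi_{\mu,\nu}^\delta}(h_\xi)(z)=\int_0^1t^{\delta/\mu-1}\,\Pi_{\mu,\nu}^\delta(t)\,h_{\xi,\delta,z}(t)\,dt,$$ $$h_{\xi,\delta,z}(t)=\left(1-\frac1\delta\right)\left(\mathrm{Re}\,\frac{h_\xi(tz)}{tz}-\frac{1-\xi(1+t)}{(1-\xi)(1+t)^2}\right)+\fr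ac1\delta\left(\mathrm{Re}\,h_\xi'(tz)-\frac{1-t-\xi(1+t)}{(1-\xi)(1+t)^3}\right).$$
   Context: $\mathbb{D}=\{z\in\mathbb{C}:|z|<1\}$. Auxiliary functions on $(0,1]$: $\Lambda_\nu^\delta(t)=\int_t^1\lambda(s)s^{-\delta/\nu}\,ds$ and $\Pi_{\mu,\nu}^\delta(t)=\int_t^1\Lambda_\nu^\delta(s)\,s^{-(\delta/\mu-\delta/\nu+1)}\,ds$ (here $\mu,\nu>0$, so $\gamma>0$). These functions are taken to be positive on $(0,1)$ and integrable on $[0,1]$. Function $q_{\mu,\nu}^\delta$: with $$k(x)=\left(1-\frac1\delta\right)\frac{1-\xi(1+x)}{(1-\xi)(1+x)^2}+\frac1\delta\,\frac{1-x-\xi(1+x)}{(1-\xi)(1+x)^3},$$ $q_{\mu,\nu}^\delta$ is the solution of $\frac{d}{dt}\left(t^{\delta/\nu}q_{\mu,\nu}^\delta(t)\right)=\frac{\delta^2}{\mu\nu}t^{\delta/\nu-1}\int_0^1k(st)\,s^{\delta/\mu-1}\,ds$ with $q_{\mu,\nu}^\delta(0)=1$. *)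

(* Defs.v *)
From HB Require Import structures.
From mathcomp Require Import all_boot all_order all_algebra.
From mathcomp Require Import complex.
From mathcomp Require Import all_classical all_reals all_analysis.

Set Implicit Arguments.
Unset Strict Implicit.
Unset Printing Implicit Defensive.

Import Order.TTheory GRing.Theory Num.Theory.
Import numFieldNormedType.Exports.

Local Open Scope classical_set_scope.
Local Open Scope ring_scope.
Local Open Scope complex_scope.

Section Auxiliary.
Context {R : realType}.
Local Notation leb := (@lebesgue_measure R).
Implicit Types (delta mu nu xi t x : R) (lambda : R -> R).

Definition Lambda lambda delta nu t : R :=
  \int[leb]_(s in `[t, 1]) (lambda s * s `^ (- (delta / nu))).

Definition Pi lambda delta mu nu t : R :=
  \int[leb]_(s in `[t, 1])
    (Lambda lambda delta nu s * s `^ (- (delta / mu - delta / nu + 1))).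

(* The two extremal real expressions from which both the kernel k of the
   equation for q and the subtracted terms of h_{xi,delta,z} are built. *)
Definition base0 xi x : R :=
  (1 - xi * (1 + x)) / ((1 - xi) * (1 + x) ^+ 2).

Definition base1 xi x : R :=
  (1 - x - xi * (1 + x)) / ((1 - xi) * (1 + x) ^+ 3).

Definition kker delta xi x : R :=
  (1 - delta^-1) * base0 xi x + delta^-1 * base1 xi x.

(* The differential equation alone leaves a free term C t^(-delta/nu); the
   condition q(0) = 1 removes it only when read as a value attained
   continuously, hence the continuity of q on [0, 1]. *)
Definition is_q delta mu nu xi (q : R -> R) : Prop :=
  [/\ {within `[0, 1], continuous q},
      q 0 = 1 &
      forall t, 0 < t < 1 ->
        is_derive t 1 (fun s => s `^ (delta / nu) * q s)
          (delta ^+ 2 / (mu * nu) * t `^ (delta / nu - 1) *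
           \int[leb]_(s in `[0, 1])
             (kker delta xi (s * t) * s `^ (delta / mu - 1)))].

Definition hxi xi (epsilon z : R[i]) : R[i] :=
  z * (1 + (epsilon + 2 * xi%:C - 1) / (2 * (1 - xi%:C)) * z) / (1 - z) ^+ 2.

Definition cderive (h : R[i] -> R[i]) (w : R[i]) : R[i] :=
  derive1 (h : R[i] -> R[i]^o) w.

(* h(w)/w for h(0) = 0, with its removable singularity at w = 0 filled in;
   the field convention 0 / 0 = 0 would give the wrong integrand at z = 0. *)
Definition quot0 (h : R[i] -> R[i]) (w : R[i]) : R[i] :=
  if w == 0 then cderive h 0 else h w / w.

Definition hdz delta xi (h : R[i] -> R[i]) (z : R[i]) t : R :=
  (1 - delta^-1) * (complex.Re (quot0 h (t%:C * z)) - base0 xi t) +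
  delta^-1 * (complex.Re (cderive h (t%:C * z)) - base1 xi t).

Definition Mop delta mu xi (P : R -> R) (h : R[i] -> R[i]) (z : R[i]) : R :=
  \int[leb]_(t in `[0, 1]) (t `^ (delta / mu - 1) * P t * hdz delta xi h z t).

End Auxiliary.

(* Main.v *)
Require Import Defs.
From HB Require Import structures.
From mathcomp Require Import all_boot all_order all_algebra.
From mathcomp Require Import complex.
From mathcomp Require Import all_classical all_reals all_analysis.
From mathcomp Require Import measurable_realfun.
From mathcomp Require Import ring lra.

(* With [G t = Re (h (t z) / (t z)) - base0 t] one has
   [h_{xi,delta,z} = G + t G' / delta], so an integration by parts turns the
   operator into [delta^-1 \int t^(1/mu - 1) phi (ln (1/t))^(1 + 2 xi) G],
   where [phi] is the nonincreasing function of the hypothesis.  The best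
   constant [epsilon] at each [t] and the monotonicity of [base0] give
   [G t >= g (r t)], [r = |z|], where in the variable [x = (1 - s) / (1 + s)],
   [s = r t], the function [g] is a positive multiple of
     [C (1 - x^2) j / E],  [j = x^2 + (2 - 2 xi) x - 1 + x^2 / E],
     [E = 1 - C (1 - x^2)],  [C = (r + Re z) / (2 r)].
   Since [j] is increasing in [x], a nonincreasing weight may be frozen at the
   zero of [j].  As [1/mu - 1 <= 1] and [ln (1/t) / hexp x] is nonincreasing for
   [hexp x = x exp (x^2 / 3 + x^4 / 16)], only the weight [t (hexp x)^(1 + 2 xi)]
   is left.  Against that weight [g] has a minorant with an explicit primitive
   [Qfun].  Indeed, for [xi = 0] and with [hexp x] replaced by [x], the function
   [- x^2 (1 - x)^3 / (2 (1 + x) E)] is, for every [C], an exact primitive of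
   [x ((1 - x) / (1 + x))^2 j / E]; in general there is an error
   [residual / E] whose sign changes once, so that [1 / E] may be frozen as
   well, and a polynomial corrector (found numerically) absorbs what remains. *)

Set Implicit Arguments.
Unset Strict Implicit.
Unset Printing Implicit Defensive.

Import Order.TTheory GRing.Theory Num.Theory.
Import numFieldNormedType.Exports.

Local Open Scope classical_set_scope.
Local Open Scope ring_scope.
Local Open Scope complex_scope.

(** * A polynomial certificate *)

Section Certificate.
Context {R : realFieldType}.
Implicit Types x y tau : R.

Definition rho x := (1 - x ^+ 2) * (1 + 2 / 3 * x ^+ 2 + x ^+ 4 / 4).

Definition residual tau x := x ^+ 2 - 2 * tau * x - 1 + (1 + tau) * rho x.

Definition corr x := (2 - x + x ^+ 2) / 6.

(** The subtracted bracket is what the corrector contributes to the derivative of [Qfun], with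
    [(2 x - 1) / 6] the derivative of [corr]. The difference splits into three terms, weighted by
    [1 - tau], [tau] and [tau (1 - tau)], each nonnegative on the unit square. *)
Lemma residual_corr tau x : 0 <= tau <= 1 -> 0 <= x <= 1 ->
  0 <= residual tau x - tau * ((1 - 4 * x - 3 * x ^+ 2 + (1 + tau) * rho x) * corr x
                          + x * (1 - x ^+ 2) * ((2 * x - 1) / 6)).
Proof.
move=> /andP[t0 t1] /andP[x0 x1].
have x21 : 0 <= 1 - x ^+ 2 by nra.
have Y0 : 0 <= corr x by rewrite /corr; nra.
have rho0 : 0 <= rho x by rewrite /rho mulr_ge0//; nra.
set N := (X in 0 <= X).
have -> : N = (1 - tau) * ((1 - x ^+ 2) * x ^+ 2 * (2 / 3 + x ^+ 2 / 4))
   + tau * (x ^+ 2 * (1 - x) *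
       (1 / 18 - x / 18 + x ^+ 2 / 3 + 7 / 36 * x ^+ 3 - x ^+ 5 / 12))
   + tau * (1 - tau) * rho x * corr x.
  by rewrite /N /residual /rho /corr; field.
have x52 : x ^+ 5 <= x ^+ 2 by apply: ler_wiXn2l.
have x3 : 0 <= x ^+ 3 by apply: exprn_ge0.
apply: addr_ge0; first apply: addr_ge0; rewrite ?mulr_ge0 ?exprn_ge0//; nra.
Qed.

(** Cross-multiplied monotonicity of [residual tau x / x^2]: it lets [residual] change sign at most
    once on [(0, 1]], from plus to minus. *)
Lemma residual_sign tau x y : 0 <= tau <= 1 -> 0 < x -> x <= y -> y <= 1 ->
  x ^+ 2 * residual tau y <= y ^+ 2 * residual tau x.
Proof.
move=> /andP[t0 t1] x0 xy y1.
have y0 : 0 < y by lra.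
rewrite -subr_ge0.
have -> : y ^+ 2 * residual tau x - x ^+ 2 * residual tau y =
  (y - x) * (tau * (x * (1 - y) + y * (1 - x)) +
    (1 + tau) * (x * y) ^+ 2 * (x + y) * (5 / 12 + (x ^+ 2 + y ^+ 2) / 4)).
  by rewrite /residual /rho; field.
have A : 0 <= x * (1 - y) by rewrite mulr_ge0//; lra.
have B : 0 <= y * (1 - x) by rewrite mulr_ge0//; lra.
have D : 0 <= (x * y) ^+ 2 by exact: sqr_ge0.
have F : 0 <= 5 / 12 + (x ^+ 2 + y ^+ 2) / 4 by nra.
rewrite mulr_ge0 ?subr_ge0// addr_ge0 ?mulr_ge0//; lra.
Qed.

Lemma residual_half tau : 0 <= tau <= 1 -> 0 <= residual tau 2^-1.
Proof. by move=> ?; rewrite /residual /rho; nra. Qed.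

Lemma residual1 tau : residual tau 1 = - 2 * tau.
Proof. by rewrite /residual /rho; field. Qed.

End Certificate.

(** * The explicit minorant *)

Section DerivRules.
Context {K : numFieldType}.
Implicit Types (f g : K -> K^o) (x a b : K) (c : K^o) (n : nat).

Lemma der_cst x c : is_derive x 1 (fun _ : K => c) 0.
Proof. exact: is_derive_cst. Qed.

Lemma der_id x : is_derive x 1 (fun y : K => y : K^o) 1.
Proof. exact: is_derive_id. Qed.

Lemma der_add f g x a b : is_derive x 1 f a -> is_derive x 1 g b ->
  is_derive x 1 (fun y => f y + g y) (a + b).
Proof. exact: is_deriveD. Qed.

Lemma der_opp f x a : is_derive x 1 f a -> is_derive x 1 (fun y => - f y) (- a).
Proof. exact: is_deriveN. Qed.

Lemma der_mul f g x a b : is_derive x 1 f a -> is_derive x 1 g b ->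
  is_derive x 1 (fun y => f y * g y) (a * g x + f x * b).
Proof.
move=> fa gb; apply: (is_derive_eq (is_deriveM fa gb)).
by rewrite addrC [X in X + _]mulrC.
Qed.

Lemma der_exp f n x a : is_derive x 1 f a ->
  is_derive x 1 (fun y => f y ^+ n) (n%:R * f x ^+ n.-1 * a).
Proof. by move=> fa; have := is_deriveX n fa; rewrite /GRing.scale/= fctE. Qed.

Lemma der_inv f x a : f x != 0 -> is_derive x 1 f a ->
  is_derive x 1 (fun y => (f y)^-1) (- a / f x ^+ 2).
Proof.
move=> fx [fd fE]; apply: DeriveDef; first exact: derivableV.
rewrite deriveV// fE.
by rewrite /GRing.scale/= mulNr mulrC mulNr.
Qed.

End DerivRules.

Section RealDerivRules.
Context {R : realType}.
Implicit Types (f : R -> R) (x a p : R).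

Lemma der_expR f x a : is_derive x 1 f a ->
  is_derive x 1 (fun y => expR (f y)) (expR (f x) * a).
Proof. by move=> fa; exact: is_derive1_comp. Qed.

Lemma der_ln f x a : 0 < f x -> is_derive x 1 f a ->
  is_derive x 1 (fun y => ln (f y)) (a / f x).
Proof.
move=> fx fa; apply: is_derive_eq; last exact: mulrC.
by apply: is_derive1_comp; exact: is_derive1_ln.
Qed.

Lemma der_powR f p x a : 0 < f x -> is_derive x 1 f a ->
  is_derive x 1 (fun y => f y `^ p) (p * f x `^ p * (a / f x)).
Proof.
move=> fx fa; apply: is_derive_eq.
  by apply: (@is_derive1_comp _ (fun y => y `^ p)); exact: is_derive1_powR.
rewrite powRB; last by rewrite (gt_eqF fx) implybT.
by rewrite powRr1 ?ltW//; ring.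
Qed.

End RealDerivRules.

(* [notypeclasses] matters: [is_derive] is a class, and its instances would
   unfold the functions and make the search diverge. *)
Ltac der := repeat first
  [ eassumption | notypeclasses refine (der_cst _ _) | notypeclasses refine (der_id _)
  | notypeclasses refine (der_add _ _) | notypeclasses refine (der_opp _)
  | notypeclasses refine (der_exp _ _) | notypeclasses refine (der_mul _ _)
  | notypeclasses refine (der_expR _) | notypeclasses refine (der_inv _ _)
  | notypeclasses refine (der_powR _ _ _) | notypeclasses refine (der_ln _ _) ].
Ltac der_eq := notypeclasses refine (is_derive_eq _ _).

Section Extremal.
Context {R : realType}.
Implicit Types x tau C e : R.

(** The [E] of the overview; at [x = cay (r t)] with [C = (r + Re z) / (2 r)] it equals
    [|1 - t z|^2 / (1 + r t)^2]. *)
Definition den C x := 1 - C + C * x ^+ 2.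

(* The logarithmic derivative of [hexp] is [rho x / (x (1 - x^2))]. *)
Definition hexp x := x * expR (x ^+ 2 / 3 + x ^+ 4 / 16).

(* [tau] stands for [2 xi]; [jfun] carries the sign of the integrand. *)
Definition jfun tau C x := x ^+ 2 + (2 - tau) * x - 1 + x ^+ 2 / den C x.

(** For [tau = 0] and [hexp x] replaced by [x] this is -2 times the exact primitive; the sign is
    undone because [x = cay (r t)] decreases in [t]. In the corrector, [e] is a frozen value of
    [den]. *)
Definition Qfun tau C e x :=
  x * (1 - x) ^+ 3 / (1 + x) * hexp x `^ (1 + tau) *
  ((den C x)^-1 - tau * corr x / e).

Lemma den_gt0 C x : 0 <= C <= 1 -> 0 < x <= 1 -> 0 < den C x.
Proof.
move=> /andP[C0 C1] /andP[x0 x1].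
have -> : den C x = x ^+ 2 + (1 - C) * ((1 - x) * (1 + x)) by rewrite /den; ring.
by rewrite ltr_pwDl ?exprn_gt0// mulr_ge0 ?mulr_ge0//; lra.
Qed.

Lemma hexp_gt0 x : 0 < x -> 0 < hexp x.
Proof. by move=> x0; rewrite mulr_gt0 ?expR_gt0. Qed.

Lemma der_hexp x : 0 < x < 1 ->
  is_derive x 1 hexp (hexp x * (rho x / (x * (1 - x ^+ 2)))).
Proof.
move=> /andP[x0 x1]; der_eq.
  by rewrite /hexp; der.
rewrite /hexp /rho /=; field; apply/andP; split; nra.
Qed.

(** Take the logarithmic derivative of the term with [1 / den], multiply it by [x (1 - x^2)] and
    replace [C (1 - x^2)] by [1 - den]: the outcome is [residual - 2 jfun]. *)
Lemma der_Qfun tau C e x : 0 <= C <= 1 -> 0 < x < 1 -> e != 0 ->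
  is_derive x 1 (Qfun tau C e)
   (- (((1 - x) / (1 + x)) ^+ 2 * hexp x `^ (1 + tau) *
     (2 * jfun tau C x / den C x -
      (residual tau x / den C x -
       tau / e * ((1 - 4 * x - 3 * x ^+ 2 + (1 + tau) * rho x) * corr x
                          + x * (1 - x ^+ 2) * ((2 * x - 1) / 6)))))).
Proof.
move=> C01 x01 e0; have /andP[x0 x1] := x01.
have E0 : 0 < den C x by rewrite den_gt0// x0 ltW.
have dE : is_derive x 1 (den C) (2 * C * x).
  by der_eq; [rewrite /den; der | rewrite /=; ring].
have dc : is_derive x 1 corr ((2 * x - 1) / 6 : R).
  by der_eq; [rewrite /corr; der | rewrite /=; field].
have dh := der_hexp x01.
have h0 := hexp_gt0 x0.
der_eq.
  rewrite /Qfun; der.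
  - by rewrite lt0r_neq0//; lra.
  - by rewrite lt0r_neq0.
rewrite /=; set P := hexp x `^ _; set h := hexp x in h0 *.
(* Eliminating [C] in favour of [den C x] makes the claim an identity of rational functions with [D]
   as a free unknown. *)
have EC : C = (1 - den C x) / (1 - x ^+ 2).
  by rewrite /den; field; nra.
rewrite /jfun /residual /rho /corr.
set D := den C x in E0 EC *.
rewrite EC; field.
have ? : 0 < 1 - x ^+ 2 by nra.
by rewrite e0 !lt0r_neq0//; lra.
Qed.

(** Take [e = den C x0] at a zero [x0] of [residual]. Around [x0] both [residual] and
    [1 / den - 1 / e] pass from plus to minus, so their product is nonnegative. *)
Lemma residual_weight tau C : 0 <= tau <= 1 -> 0 <= C <= 1 ->
  exists2 e, 1 - 3 / 4 * C <= e &
    forall x, 0 < x < 1 -> 0 <= residual tau x * ((den C x)^-1 - e^-1).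
Proof.
move=> t01 C01.
have cf : {within `[2^-1, 1], continuous (fun x : R => residual tau x)}.
  apply: continuous_subspaceT => x.
  apply: differentiable_continuous; apply/derivable1_diffP.
  apply: (@ex_derive _ _ _ x 1 (residual tau)).
  by rewrite /residual /rho; der.
have [||x0] := @IVT R (residual tau) 2^-1 1 0 _ cf.
- by lra.
- rewrite residual1 ge_min le_max residual_half//= andbT.
  by apply/orP; right; lra.
rewrite in_itv/= => /andP[x0h x01] r0.
have dx0 : 0 < den C x0 by apply: den_gt0 => //; lra.
exists (den C x0).
  (* The zero was sought in [[1/2, 1]], so [e] is at least [den C (1/2) = 1 - 3/4 C]. *)
  have x0s : 0 <= C * (x0 ^+ 2 - 1 / 4) by rewrite mulr_ge0//; nra.
  by rewrite /den; lra.
move=> x /andP[x_gt0 x_lt1].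
have dx : 0 < den C x by apply: den_gt0 => //; lra.
have -> : (den C x)^-1 - (den C x0)^-1 =
    C * (x0 + x) / (den C x * den C x0) * (x0 - x).
  have -> : (den C x)^-1 - (den C x0)^-1 =
    (den C x0 - den C x) / (den C x * den C x0) by field; rewrite !lt0r_neq0.
  by rewrite {1 2}/den; field; rewrite !lt0r_neq0.
have K : 0 <= C * (x0 + x) / (den C x * den C x0).
  by rewrite divr_ge0 ?mulr_ge0//; lra.
rewrite mulrCA mulr_ge0//.
have [le|/ltW le] := leP x x0.
- have := residual_sign t01 x_gt0 le x01.
  rewrite r0 mulr0 pmulr_rge0; last by rewrite exprn_gt0//; lra.
  by move=> ?; rewrite mulr_ge0//; lra.
- have := residual_sign t01 (_ : 0 < x0) le (ltW x_lt1); rewrite r0 mulr0 => H.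
  rewrite mulr_le0//; last by lra.
  by rewrite -(@pmulr_rle0 _ (x0 ^+ 2)) ?H ?exprn_gt0//; lra.
Qed.

(** The sign hypothesis allows [residual / den] to be replaced by [residual / e]; what is then
    subtracted is [1 / e] times the quantity of [residual_corr]. *)
Lemma Qfun_lower tau C e x : 0 <= tau <= 1 -> 0 <= C <= 1 -> 0 < e ->
  0 < x < 1 -> 0 <= residual tau x * ((den C x)^-1 - e^-1) ->
  2 * jfun tau C x / den C x -
      (residual tau x / den C x -
       tau / e * ((1 - 4 * x - 3 * x ^+ 2 + (1 + tau) * rho x) * corr x
                          + x * (1 - x ^+ 2) * ((2 * x - 1) / 6)))
  <= 2 * jfun tau C x / den C x.
Proof.
move=> t01 C01 e0 /andP[x0 x1] H; rewrite gerBl.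
have /(@mulr_ge0 _ e^-1) : 0 <= e^-1 by rewrite invr_ge0 ltW.
move=> /(_ _ (@residual_corr _ tau x t01 _)).
rewrite (ltW x0) (ltW x1) => /(_ isT); lra.
Qed.

(** A nonpositive [jfun] forces [x^2 + x <= 1], which keeps [den C x] below [3 e], while
    [tau * corr x <= 1/3]. This gives the minorant its sign near [t = 1]. *)
Lemma Qfun_ge0 tau C e x : 0 <= tau <= 1 -> 0 <= C <= 1 ->
  1 - 3 / 4 * C <= e -> 0 < x < 1 -> jfun tau C x <= 0 -> 0 <= Qfun tau C e x.
Proof.
move=> t01 C01 He /andP[x0 x1]; rewrite /jfun => j0.
have dx : 0 < den C x by apply: den_gt0 => //; lra.
have xx : x ^+ 2 + x <= 1.
  have : 0 <= x ^+ 2 / den C x by rewrite divr_ge0 ?sqr_ge0 ?ltW.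
  by nra.
have e0 : 0 < e by lra.
rewrite /Qfun; apply: mulr_ge0.
  by rewrite mulr_ge0 ?powR_ge0// divr_ge0 ?mulr_ge0 ?exprn_ge0//; lra.
rewrite subr_ge0 -[X in _ <= X]mul1r ler_pdivrMr// mulrAC ler_pdivlMr// mul1r.
have c3 : tau * corr x <= 1 / 3 by rewrite /corr; nra.
have d1 : den C x <= 3 * e.
  by rewrite /den; nra.
by nra.
Qed.

End Extremal.

(** * Monotonicity of the logarithm relative to [hexp] *)

Section Mono.
Context {R : realType}.
Implicit Types (f df : R -> R) (a b s t r x : R).

Lemma der_continuous f x a : is_derive x 1 f a -> {for x, continuous f}.
Proof.
move=> fa; apply: differentiable_continuous; apply/derivable1_diffP.
exact: ex_derive.
Qed.

Lemma ge0_der_le f df a b : a <= b ->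
  (forall x, a <= x <= b -> is_derive x 1 f (df x)) ->
  (forall x, a <= x <= b -> 0 <= df x) -> f a <= f b.
Proof.
rewrite le_eqVlt => /predU1P[-> //|ab] fd df0.
have [||c] := @MVT R f df a b ab.
- by move=> x; rewrite in_itv/= => /andP[? ?]; apply: fd; rewrite !ltW.
- apply: continuous_in_subspaceT => x; rewrite inE/= in_itv/= => /fd.
  exact: der_continuous.
- rewrite in_itv/= => /andP[? ?] E; rewrite -subr_ge0 E.
  by rewrite mulr_ge0 ?df0 ?subr_ge0 ?ltW.
Qed.

Definition cay s := (1 - s) / (1 + s).

Lemma cay_itv s : 0 < s < 1 -> 0 < cay s < 1.
Proof.
move=> /andP[s0 s1]; rewrite /cay divr_gt0 ?ltr_pdivrMr ?mul1r//; lra.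
Qed.

Lemma der_cay s : 0 <= s -> is_derive s 1 cay (- 2 / (1 + s) ^+ 2).
Proof.
move=> s0; der_eq.
  by rewrite /cay; der; rewrite lt0r_neq0//; lra.
by rewrite /=; field; rewrite lt0r_neq0//; lra.
Qed.

Lemma rho_gt0 (x : R) : 0 <= x < 1 -> 0 < rho x.
Proof. by move=> ?; rewrite /rho mulr_gt0//; nra. Qed.

(** With [x = cay s] one has [ln (1 / s) = 2 artanh x], so the claim is [artanh x <= x / rho x].
    Both sides agree at [s = 1], and their derivatives are compared. *)
Lemma ln_rho s : 0 < s < 1 -> ln (1 / s) * rho (cay s) <= 2 * cay s.
Proof.
move=> /andP[s0 s1].
have cays u : 0 < u <= 1 -> 0 <= cay u < 1.
  by move=> ?; rewrite /cay divr_ge0 ?ltr_pdivrMr ?mul1r//; lra.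
pose F u := - (2 * cay u / rho (cay u) + ln u).
pose dF u := u^-1 * ((1 - cay u ^+ 2) * (1 + cay u ^+ 2 / 3 + 5 / 4 * cay u ^+ 4
   + 5 / 4 * cay u ^+ 6) / rho (cay u) ^+ 2 - 1).
have : F s <= F 1.
  apply: (@ge0_der_le F dF s 1 (ltW s1)) => u /andP[su u1].
    have u0 : 0 < u by lra.
    have ru : 0 < rho (cay u) by rewrite rho_gt0// cays// u0.
    have dc := der_cay (ltW u0).
    der_eq.
      rewrite /F; der.
      by rewrite lt0r_neq0.
    (* In this form the derivative is [1 / u] times a function of [cay u] alone. *)
    have -> : - 2 / (1 + u) ^+ 2 = - (1 - cay u ^+ 2) / (2 * u).
      by rewrite /cay; field; rewrite !lt0r_neq0//; lra.
    rewrite /dF; set x := cay u; rewrite /rho/=.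
    have /cays /andP[x0 x1] : 0 < u <= 1 by rewrite u0.
    rewrite -/x in x0 x1; have ? : 0 <= x ^+ 4 by exact: exprn_ge0.
    by field; apply/and3P; split; rewrite lt0r_neq0//; nra.
  have u0 : 0 < u by lra.
  have /cays /andP[x0 x1] : 0 < u <= 1 by rewrite u0.
  rewrite /dF; apply: mulr_ge0; first by rewrite invr_ge0 ltW.
  rewrite subr_ge0.
  rewrite ler_pdivlMr ?mul1r; last by rewrite exprn_gt0 ?rho_gt0// x0.
  rewrite /rho; set x := cay u in x0 x1 *.
  have x2 : 0 <= x ^+ 2 by exact: sqr_ge0.
  have x21 : 0 <= 1 - x ^+ 2 by nra.
  rewrite exprMn expr2 -mulrA ler_wpM2l//.
  have -> : x ^+ 4 = (x ^+ 2) ^+ 2 by ring.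
  have -> : x ^+ 6 = (x ^+ 2) ^+ 3 by ring.
  set v := x ^+ 2 in x2 x21 *.
  (* After cancelling [1 - x^2], the difference is a polynomial in [v = x^2] with nonnegative
     coefficients. *)
  rewrite -subr_ge0; set d := (X in 0 <= X).
  have -> : d = v ^+ 2 * (59 / 36 + 67 / 36 * v + 13 / 48 * v ^+ 2 + v ^+ 3 / 16).
    by rewrite /d; field.
  have v2 : 0 <= v ^+ 2 by exact: sqr_ge0.
  have v3 : 0 <= v ^+ 3 by exact: exprn_ge0.
  by rewrite mulr_ge0//; lra.
have -> : F 1 = 0.
  by rewrite /F /cay subrr mul0r mulr0 mul0r ln1 addr0 oppr0.
have rs : 0 < rho (cay s) by rewrite rho_gt0// cays// s0 ltW.
rewrite /F oppr_le0 div1r lnV ?posrE// => H.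
by rewrite -ler_pdivlMr//; lra.
Qed.

(** The sign of the derivative is decided by [ln (1 / u) * rho x <= 2 x] at [x = cay (r u)]; as
    [ln (1 / u) <= ln (1 / (r u))], this follows from [ln_rho] at [r u]. *)
Lemma ln_hexp_le r s t : 0 < r < 1 -> 0 < s -> s <= t -> t < 1 ->
  ln (1 / t) / hexp (cay (r * t)) <= ln (1 / s) / hexp (cay (r * s)).
Proof.
move=> /andP[r0 r1] s0 st t1.
pose V u := - (ln (1 / u) / hexp (cay (r * u))).
pose dV u := (hexp (cay (r * u)))^-1 / u *
  (1 - ln (1 / u) * rho (cay (r * u)) / (2 * cay (r * u))).
suff : V s <= V t by rewrite lerN2.
apply: (@ge0_der_le V dV) => // u /andP[su ut];
  (have u0 : 0 < u by lra); (have ru0 : 0 < r * u by rewrite mulr_gt0);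
  (have ru1 : r * u < 1 by nra);
  (have /cay_itv c01 : 0 < r * u < 1 by rewrite ru0 ru1);
  have /andP[c0 c1] := c01; have h0 := hexp_gt0 c0.
  have dln : is_derive u 1 (fun v => ln (1 / v)) (- u^-1).
    der_eq; first by der; rewrite ?divr_gt0// lt0r_neq0.
    by rewrite /=; field; rewrite lt0r_neq0.
  have dh : is_derive u 1 (fun v => hexp (cay (r * v)))
     (hexp (cay (r * u)) * (rho (cay (r * u)) /
      (cay (r * u) * (1 - cay (r * u) ^+ 2))) * (- 2 / (1 + r * u) ^+ 2 * r)).
    notypeclasses refine (@is_derive1_comp _ hexp _ u _ _ (der_hexp c01) _).
    notypeclasses refine (@is_derive1_comp _ cay _ u _ _ (der_cay (ltW ru0)) _).
    by der_eq; [der|rewrite /=; ring].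
  der_eq; first by rewrite /V; der; rewrite lt0r_neq0.
  rewrite /dV /=.
  have -> : - 2 / (1 + r * u) ^+ 2 * r = - (1 - cay (r * u) ^+ 2) / (2 * u).
    by rewrite /cay; field; rewrite !lt0r_neq0//; lra.
  set x := cay _ in c0 c1 *; set h := hexp _ in h0 *; set q := rho _.
  by field; rewrite !lt0r_neq0//; nra.
rewrite /dV; apply: mulr_ge0; first by rewrite divr_ge0 ?invr_ge0 ?ltW.
rewrite subr_ge0 ler_pdivrMr ?mul1r; last by lra.
apply: le_trans (ln_rho _); last by rewrite ru0.
rewrite ler_wpM2r//; first by rewrite ltW// rho_gt0// ltW.
rewrite !div1r ler_ln ?posrE ?invr_gt0// lef_pV2 ?posrE//.
by rewrite ger_pMl// ltW.
Qed.

End Mono.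

(** * A minorant for a general nonincreasing weight *)

Section Minorant.
Context {R : realType}.
Implicit Types (phi : R -> R) (a r s t x y tau C e p : R).

(** The quotient [x^2 / den C x] is [1 / (C + (1 - C) / x^2)], and the polynomial part increases
    because [tau <= 2]. *)
Lemma jfun_le tau C x y : 0 <= tau <= 1 -> 0 <= C <= 1 -> 0 < x -> x <= y ->
  y <= 1 -> jfun tau C x <= jfun tau C y.
Proof.
move=> t01 C01 x0 xy y1; rewrite /jfun.
have dx : 0 < den C x by apply: den_gt0 => //; lra.
have dy : 0 < den C y by apply: den_gt0 => //; lra.
apply: lerD; first by nra.
rewrite ler_pdivrMr// mulrAC ler_pdivlMr// /den.
have : 0 <= (1 - C) * (y ^+ 2 - x ^+ 2) by rewrite mulr_ge0//; nra.
by lra.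
Qed.

Lemma jfun1 tau C : jfun tau C 1 = 3 - tau.
Proof.
rewrite /jfun; have -> : den C 1 = 1 by rewrite /den; ring.
by field.
Qed.

Lemma cay_le s t : 0 <= s -> s <= t -> cay t <= cay s.
Proof.
move=> s0 st; rewrite /cay ler_pdivrMr; last by lra.
by rewrite mulrAC ler_pdivlMr; nra.
Qed.

Lemma cayK s : 0 <= s -> cay (cay s) = s.
Proof. by move=> s0; rewrite /cay; field; rewrite !lt0r_neq0//; lra. Qed.

Lemma powR_le0_le p s t : p <= 0 -> 0 < s -> s <= t -> t `^ p <= s `^ p.
Proof.
move=> p0 s0 st; rewrite -[p]opprK !(powRN _ (- p)).
rewrite lef_pV2 ?posrE ?powR_gt0//; last by lra.
by apply: ge0_ler_powR; rewrite ?nnegrE//; lra.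
Qed.

(** The point [t = 0] corresponds to [x = cay 0 = 1], an end that [der_Qfun] leaves out. *)
Lemma continuous_Qfun1 tau C e : {for 1, continuous (Qfun tau C e)}.
Proof.
have h1 : 0 < hexp (1 : R) by rewrite hexp_gt0.
have dh : is_derive (1 : R) 1 hexp (hexp 1 * (1 + 2 / 3 + 1 / 4) : R).
  der_eq; first by rewrite /hexp; der.
  by rewrite /hexp/=; field.
notypeclasses refine (der_continuous _).
rewrite /Qfun; der; first by rewrite lt0r_neq0//; lra.
have -> : den C 1 = 1 by rewrite /den; ring.
exact: oner_neq0.
Qed.

(* With [y = cay (r t)] and weight [w], both sides of the minorant share the
   factor [w C P (1 - y)^2 / r]. *)
Lemma minorant_gap (w C P r y D j S : R) : 0 < y -> 0 < r -> 0 < D ->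
  (1 - y) / (1 + y) / r * P * C * (1 - y ^+ 2) / D * (w * j) -
  w * C / r ^+ 2 * (- (((1 - y) / (1 + y)) ^+ 2 * P * S) *
    (- 2 / (1 + (1 - y) / (1 + y)) ^+ 2 * r)) =
  w * C * P / r * (1 - y) ^+ 2 / 2 * (2 * j / D - S).
Proof.
move=> y0 r0 D0; have -> : 1 + (1 - y) / (1 + y) = 2 / (1 + y).
  by field; rewrite lt0r_neq0//; lra.
by field; rewrite !lt0r_neq0//; lra.
Qed.

(** A minorant in differential form: [q] starts at 0, is nonnegative near 1 and grows no faster than
    a primitive of the weighted integrand, which suffices for positivity of the integral. *)
Lemma weighted_minorant tau C r a phi : 0 <= tau <= 1 -> 0 <= C <= 1 ->
  0 < r < 1 -> 0 <= a <= 1 ->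
  (forall t, 0 < t < 1 -> 0 <= phi t) ->
  (forall s t, 0 < s -> s <= t -> t < 1 -> phi t <= phi s) ->
  exists (q dq : R -> R) (b : R), [/\ 0 < b < 1,
    forall t, 0 < t < 1 -> is_derive t 1 q (dq t),
    forall t, 0 < t < 1 -> dq t <=
      t `^ a * phi t * ln (1 / t) `^ (1 + tau) *
      (C * (1 - cay (r * t) ^+ 2) * jfun tau C (cay (r * t))
       / den C (cay (r * t))),
    forall t, b <= t < 1 -> 0 <= q t &
    q t @[t --> 0] --> 0].
Proof.
move=> t01 C01 /andP[r0 r1] /andP[a0 a1] phi0 phi_le.
pose x t := cay (r * t).
have rt t : 0 < t < 1 -> 0 < r * t < 1 by move=> ?; apply/andP; split; nra.
have x01 t : 0 < t < 1 -> 0 < x t < 1 by move=> /rt; exact: cay_itv.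
have dx t : 0 < t < 1 -> 0 < den C (x t).
  by move=> /x01/andP[? ?]; apply: den_gt0 => //; lra.
have x21 t : 0 < t < 1 -> 0 < 1 - x t ^+ 2 by move=> /x01/andP[? ?]; nra.
have [j0|] := pselect (forall t, 0 < t < 1 -> 0 <= jfun tau C (x t)).
  exists (fun=> 0), (fun=> 0), 2^-1; split=> //.
  - by lra.
  - by move=> *; exact: der_cst.
  - move=> t t01'; apply: mulr_ge0.
      by rewrite !mulr_ge0 ?powR_ge0 ?phi0.
    apply: divr_ge0; last exact/ltW/dx.
    rewrite mulr_ge0 ?j0// mulr_ge0//; last exact/ltW/x21.
    by case/andP : C01.
  - exact: cvg_cst.
move=> /existsNP[t2] /not_implyP[t2_01] /negP; rewrite -ltNge => j2.
(* As [t] tends to 0, [x t] tends to 1, where [jfun] is [3 - tau > 0]. The weight will be frozen at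
   the zero [t1]. *)
have [t1 [t1_0 t12 j1]] : exists t1, [/\ 0 < t1, t1 < t2 & jfun tau C (x t1) = 0].
  have /andP[x2_0 x2_1] := x01 _ t2_01.
  have [||x1] := @IVT R (jfun tau C) (x t2) 1 0 (ltW x2_1).
  - apply: continuous_in_subspaceT => y; rewrite inE/= in_itv/= => /andP[y0 y1].
    notypeclasses refine (der_continuous _); rewrite /jfun /den; der.
    by rewrite lt0r_neq0// den_gt0//; lra.
  - rewrite ge_min le_max (ltW j2)/=; apply/orP; right.
    by rewrite jfun1; lra.
  rewrite in_itv/= => /andP[x21' x11] j1.
  have xx1 : x (cay x1 / r) = x1.
    by rewrite /x /cay; field; rewrite !lt0r_neq0//; lra.
  exists (cay x1 / r); rewrite xx1; split => //.
  - rewrite divr_gt0// /cay divr_gt0//; last by lra.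
    rewrite subr_gt0 lt_neqAle x11 andbT; apply/eqP => x1E.
    by move: j1; rewrite x1E jfun1; lra.
  - rewrite ltNge; apply/negP => t21.
    have : x (cay x1 / r) <= x t2.
      by apply: cay_le; [rewrite mulr_ge0//; lra|rewrite ler_pM2l].
    rewrite xx1 => x12; have E : x1 = x t2 by apply/eqP; rewrite eq_le x12.
    by move: j2; rewrite -E j1 ltxx.
have t1_01 : 0 < t1 < 1 by lra.
have [e He residual_ge0] := residual_weight t01 C01.
have e0 : 0 < e by lra.
(* The full weight is [t * W t] times the power [1 + tau] of [hexp (x t)]; [W] collects
   nonincreasing factors, among them [t^(a - 1)] because [a <= 1]. *)
pose V t := ln (1 / t) / hexp (x t).
pose W t := t `^ (a - 1) * phi t * V t `^ (1 + tau).
have V0 t : 0 < t < 1 -> 0 <= V t.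
  move=> t01'; have /andP[? ?] := x01 _ t01'; have /andP[? ?] := t01'.
  rewrite /V divr_ge0//; last by rewrite ltW// hexp_gt0.
  by rewrite ln_ge0// div1r invf_ge1// ltW.
have W0 t : 0 < t < 1 -> 0 <= W t.
  by move=> ?; rewrite /W !mulr_ge0 ?powR_ge0 ?phi0.
have W_le s t : 0 < s -> s <= t -> t < 1 -> W t <= W s.
  move=> s0 st t1'; have ? : 0 < t < 1 by lra. have ? : 0 < s < 1 by lra.
  have p0 u : 0 <= u `^ (a - 1) by exact: powR_ge0.
  apply: ler_pM.
  - by apply: mulr_ge0; [exact: p0|exact: phi0].
  - exact: powR_ge0.
  - apply: ler_pM; rewrite ?phi0 ?phi_le//.
    by apply: powR_le0_le => //; lra.
  - apply: ge0_ler_powR; rewrite ?nnegrE ?V0//; first by lra.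
    by rewrite /V ln_hexp_le// r0.
(* In the variable [s = r t], the factor [t] and the differential [dt] each contribute [1 / r]. *)
pose k := W t1 * C / r ^+ 2.
have C0 : 0 <= C by case/andP : C01.
have Wt1 := W0 _ t1_01.
have k0 : 0 <= k by apply: divr_ge0; [exact: mulr_ge0|exact: sqr_ge0].
pose dQ y := (- (((1 - y) / (1 + y)) ^+ 2 * hexp y `^ (1 + tau) *
     (2 * jfun tau C y / den C y -
      (residual tau y / den C y -
       tau / e * ((1 - 4 * y - 3 * y ^+ 2 + (1 + tau) * rho y) * corr y
                          + y * (1 - y ^+ 2) * ((2 * y - 1) / 6)))))).
have j_le0 t : t1 <= t < 1 -> jfun tau C (x t) <= 0.
  move=> /andP[t1t t_1]; rewrite -j1.
  have /andP[? ?] : 0 < x t < 1 by apply: x01; lra.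
  have /andP[? ?] := x01 _ t1_01.
  by apply: jfun_le => //; [apply: cay_le; [rewrite mulr_ge0//; lra|rewrite ler_pM2l]|lra].
have j_ge0 t : 0 < t <= t1 -> 0 <= jfun tau C (x t).
  move=> /andP[t0 tt1]; rewrite -j1.
  have /andP[? ?] : 0 < x t < 1 by apply: x01; lra.
  have /andP[? ?] := x01 _ t1_01.
  by apply: jfun_le => //; [apply: cay_le; [rewrite mulr_ge0//; lra|rewrite ler_pM2l]|lra].
exists (fun t => k * Qfun tau C e (x t)),
  (fun t => k * (dQ (x t) * (- 2 / (1 + r * t) ^+ 2 * r))), t1; split.
- exact: t1_01.
- move=> t t01'; have /andP[rt0 rt1] := rt _ t01'.
  der_eq.
    notypeclasses refine (der_mul (der_cst _ _) _).
    notypeclasses refine (@is_derive1_comp _ (Qfun tau C e) _ t _ _ _ _).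
      exact: (der_Qfun tau C01 (x01 _ t01') (lt0r_neq0 e0)).
    notypeclasses refine (@is_derive1_comp _ cay _ t _ _ (der_cay (ltW rt0)) _).
    by der.
  by rewrite /= /dQ; ring.
- move=> t t01'; have /andP[xt0 xt1] := x01 _ t01'.
  have /andP[t0 t_1] := t01'.
  have /andP[rt0 rt1] := rt _ t01'.
  have h0 := hexp_gt0 xt0; have d0 := dx _ t01'.
  have -> : t `^ a * phi t * ln (1 / t) `^ (1 + tau) =
      t * (W t * hexp (x t) `^ (1 + tau)).
    have -> : t `^ a = t * t `^ (a - 1).
      rewrite -{2}[t]powRr1 ?(ltW t0)// -powRD ?(gt_eqF t0) ?implybT//.
      by congr (_ `^ _); ring.
    have -> : ln (1 / t) = V t * hexp (x t) by rewrite /V divfK// lt0r_neq0.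
    by rewrite powRM ?V0// ?(ltW h0)// /W; ring.
  have P0 := powR_ge0 (hexp (x t)) (1 + tau).
  set P := hexp _ `^ _ in P0 *.
  (* Before [t1] the weight is larger and [jfun] nonnegative; after [t1] both comparisons are
     reversed. *)
  have WJ : W t1 * jfun tau C (x t) <= W t * jfun tau C (x t).
    have [tt1|/ltW tt1] := leP t t1.
      apply: ler_wpM2r; first by apply: j_ge0; rewrite t0.
      by apply: W_le => //; case/andP : t1_01.
    apply: ler_wnM2r; first by apply: j_le0; rewrite tt1.
    exact: W_le.
  apply: (@le_trans _ _ (t * P * C * (1 - x t ^+ 2) / den C (x t) *
      (W t1 * jfun tau C (x t)))).
    have := Qfun_lower t01 C01 e0 (x01 _ t01') (residual_ge0 _ (x01 _ t01')).
    have E1 : r * t = (1 - x t) / (1 + x t) by rewrite -/(cay (x t)) cayK ?ltW.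
    have E2 : t = (1 - x t) / (1 + x t) / r.
      by rewrite -E1; field; rewrite lt0r_neq0.
    rewrite /dQ E1 [X in _ <= X * _ * _ * _ / _ * _]E2 /k -/P.
    set S := (X in X <= _ -> _); rewrite -/S.
    move: xt0 xt1 d0; set y := x t => y0 y1 d0 SJ.
    rewrite -subr_ge0 minorant_gap// mulr_ge0 ?subr_ge0//.
    apply: divr_ge0 => //; apply: mulr_ge0; last exact: sqr_ge0.
    apply: divr_ge0; last exact: ltW.
    by apply: mulr_ge0 => //; exact: mulr_ge0.
  have -> : t * (W t * P) * (C * (1 - x t ^+ 2) * jfun tau C (x t) / den C (x t)) =
     t * P * C * (1 - x t ^+ 2) / den C (x t) * (W t * jfun tau C (x t)).
    by ring.
  apply: ler_wpM2l; last exact: WJ.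
  apply: divr_ge0; last exact: ltW.
  apply: mulr_ge0; last exact/ltW/x21.
  by apply: mulr_ge0 => //; apply: mulr_ge0 => //; exact: ltW.
- move=> t /andP[t1t t_1]; rewrite mulr_ge0//.
  by apply: Qfun_ge0 => //; [apply: x01|apply: j_le0]; rewrite ?t1t//; lra.
- rewrite -[0 in X in _ --> X](mulr0 k); apply: cvgMr.
  have E : Qfun tau C e 1 = 0 by rewrite /Qfun subrr expr0n/= mulr0 !mul0r.
  have x0 : x 0 = 1 by rewrite /x /cay mulr0 subr0 addr0 divr1.
  have cx : {for 0, continuous x}.
    notypeclasses refine (der_continuous _); rewrite /x /cay; der.
    by rewrite mulr0 addr0 oner_neq0.
  have cQ : {for x 0, continuous (Qfun tau C e)}.
    by rewrite x0; exact: continuous_Qfun1.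
  have Q0 : (Qfun tau C e \o x) 0 = 0 by rewrite /comp x0 E.
  suff : (Qfun tau C e \o x) t @[t --> 0] --> (Qfun tau C e \o x) 0 by rewrite Q0.
  exact: (continuous_comp cx cQ).
Qed.

End Minorant.

(** * The extremal function on a ray *)

Section Complex.
Context {R : realType}.
Implicit Types (xi t : R) (epsilon z w : R[i]).

Definition coef xi epsilon : R[i] := (epsilon + 2 * xi%:C - 1) / (2 * (1 - xi%:C)).

Lemma cderive_hxi xi epsilon w : w != 1 ->
  let u := (1 - w)^-1 in let c := coef xi epsilon in
  cderive (hxi xi epsilon) w =
   (1 + c) * u ^+ 2 - c * u + (u - 1) * (2 * (1 + c) * u ^+ 2 - c * u).
Proof.
move=> w1 u c; rewrite /cderive derive1E.
have w0 : 1 - w != 0 by rewrite subr_eq0 eq_sym.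
suff H : @is_derive R[i] R[i]^o R[i]^o w 1 (hxi xi epsilon)
   ((1 + c) * u ^+ 2 - c * u + (u - 1) * (2 * (1 + c) * u ^+ 2 - c * u)) by rewrite derive_val.
der_eq.
  rewrite /hxi -/(coef xi epsilon); der.
  by rewrite expf_neq0.
rewrite /= /u -/c; field.
by rewrite w0.
Qed.


Lemma quot0_hxi xi epsilon w : w != 1 ->
  let u := (1 - w)^-1 in let c := coef xi epsilon in
  quot0 (hxi xi epsilon) w = (1 + c) * u ^+ 2 - c * u.
Proof.
move=> w1 u c; rewrite /quot0; case: (eqVneq w 0) => [w0|w0].
  rewrite /u w0 cderive_hxi ?subr0 ?invr1; first by rewrite /c; ring.
  by rewrite eq_sym oner_neq0.
have w0' : 1 - w != 0 by rewrite subr_eq0 eq_sym.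
rewrite /hxi -/(coef xi epsilon) -/c /u; field.
by rewrite w0 w0'.
Qed.

Section Parts.
Variables (a b c1 c2 : R).

(** For [z = a + i b] and [c = c1 + i c2]: [sqd] is [|1 - t z|^2], [reu] and [imu] are the parts of
    [u = 1 / (1 - t z)], and [req] is the real part of [h (t z) / (t z)]. *)
Definition sqd t := (1 - t * a) ^+ 2 + (t * b) ^+ 2.
Definition reu t := (1 - t * a) / sqd t.
Definition imu t := t * b / sqd t.
Definition req t := (1 + c1) * (reu t ^+ 2 - imu t ^+ 2) -
  c2 * (2 * reu t * imu t) - (c1 * reu t - c2 * imu t).
Definition dreu t := (- a * sqd t - (1 - t * a) *
  (- 2 * a * (1 - t * a) + 2 * b * (t * b))) / sqd t ^+ 2.
Definition dimu t := (b * sqd t - t * b *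
  (- 2 * a * (1 - t * a) + 2 * b * (t * b))) / sqd t ^+ 2.
Definition dreq t := 2 * (1 + c1) * (reu t * dreu t - imu t * dimu t) -
  2 * c2 * (dreu t * imu t + reu t * dimu t) - (c1 * dreu t - c2 * dimu t).

Lemma der_req t : sqd t != 0 -> is_derive t 1 req (dreq t).
Proof.
move=> D0.
have dd : is_derive t 1 sqd (- 2 * a * (1 - t * a) + 2 * b * (t * b)).
  by der_eq; [rewrite /sqd; der|rewrite /=; ring].
have du : is_derive t 1 reu (dreu t).
  by der_eq; [rewrite /reu; der|rewrite /dreu/=; field].
have dv : is_derive t 1 imu (dimu t).
  by der_eq; [rewrite /imu; der|rewrite /dimu/=; field].
by der_eq; [rewrite /req; der|rewrite /dreq/=; ring].
Qed.

Lemma u_parts t : sqd t != 0 ->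
  (1 - t%:C * (a +i* b))^-1 = reu t +i* imu t.
Proof.
move=> D0; have E : (1 - t%:C * (a +i* b)) * (reu t +i* imu t) = 1.
  apply/eqP; rewrite eq_complex /=; apply/andP; split; apply/eqP.
    by rewrite /reu /imu /sqd; field.
  by rewrite /reu /imu /sqd; field.
have N : 1 - t%:C * (a +i* b) != 0.
  by apply/eqP => N; move: E => /esym/eqP; rewrite N mul0r oner_eq0.
by apply: (mulfI N); rewrite E mulfV.
Qed.

Lemma req_parts t : sqd t != 0 ->
  let u := (1 - t%:C * (a +i* b))^-1 in let c := c1 +i* c2 in
  complex.Re ((1 + c) * u ^+ 2 - c * u) = req t.
Proof.
move=> D0 u c; rewrite /u u_parts// /c /req /=; ring.
Qed.

Lemma dreq_parts t : sqd t != 0 ->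
  let u := (1 - t%:C * (a +i* b))^-1 in let c := c1 +i* c2 in
  complex.Re ((1 + c) * u ^+ 2 - c * u + (u - 1) * (2 * (1 + c) * u ^+ 2 - c * u)) =
  req t + t * dreq t.
Proof.
move=> D0 u c; rewrite /u u_parts// /c.
(* This and the next identity are the real and imaginary parts of [t u' = u^2 - u]. *)
have dU : t * dreu t = reu t ^+ 2 - imu t ^+ 2 - reu t.
  by rewrite /dreu /reu /imu /sqd; field.
have dV : t * dimu t = 2 * reu t * imu t - imu t.
  by rewrite /dimu /reu /imu /sqd; field.
have -> : t * dreq t =
    2 * (1 + c1) * (reu t * (t * dreu t) - imu t * (t * dimu t)) -
    2 * c2 * (t * dreu t * imu t + reu t * (t * dimu t)) -
    (c1 * (t * dreu t) - c2 * (t * dimu t)) by rewrite /dreq; ring.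
rewrite dU dV /req /=; ring.
Qed.

End Parts.

Lemma sqd_gt0 a b t : a ^+ 2 + b ^+ 2 < 1 -> 0 <= t <= 1 -> 0 < sqd a b t.
Proof.
move=> ab1 /andP[t0 t1]; rewrite lt_neqAle eq_sym; apply/andP; split; last first.
  by rewrite /sqd addr_ge0 ?sqr_ge0.
rewrite /sqd paddr_eq0 ?sqr_ge0// !sqrf_eq0; apply/negP => /andP[/eqP E1 /eqP E2].
have : t ^+ 2 * (a ^+ 2 + b ^+ 2) = 1.
  have -> : t ^+ 2 * (a ^+ 2 + b ^+ 2) = (1 - (1 - t * a)) ^+ 2 + (t * b) ^+ 2 by ring.
  by rewrite E1 E2; ring.
have q0 : 0 <= a ^+ 2 + b ^+ 2 by rewrite addr_ge0 ?sqr_ge0.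
have t2 : t ^+ 2 <= 1 by rewrite expr_le1.
have := ler_wpM2r q0 t2; lra.
Qed.

Lemma base0_le xi s t : 0 <= xi <= 2^-1 -> 0 <= s -> s <= t -> t <= 1 ->
  base0 xi t <= base0 xi s.
Proof.
move=> /andP[x0 x1] s0 st t1; rewrite /base0.
have X : 0 < 1 - xi by lra.
have S : 0 < 1 + s by lra.
have T : 0 < 1 + t by lra.
rewrite -subr_ge0.
have -> : (1 - xi * (1 + s)) / ((1 - xi) * (1 + s) ^+ 2) -
  (1 - xi * (1 + t)) / ((1 - xi) * (1 + t) ^+ 2) =
  (t - s) * (2 + s + t - xi * ((1 + s) * (1 + t))) /
   ((1 - xi) * (1 + s) ^+ 2 * (1 + t) ^+ 2).
  by field; rewrite !lt0r_neq0.
have K : xi * ((1 + s) * (1 + t)) <= 2^-1 * (2 * (1 + t)).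
  apply: ler_pM => //; first by rewrite mulr_ge0// ltW.
  by rewrite ler_wpM2r ?(ltW T)//; lra.
apply: divr_ge0; first by rewrite mulr_ge0//; lra.
by rewrite !mulr_ge0 ?sqr_ge0 ?ltW.
Qed.

(* The extremal case of [`|epsilon| = 1] is the pointwise bound
   [Re (epsilon w u^2) >= - |w| |u|^2]. *)
Lemma req_lower a b e1 e2 xi r t : 0 <= xi <= 2^-1 ->
  e1 ^+ 2 + e2 ^+ 2 = 1 -> 0 < r < 1 -> a ^+ 2 + b ^+ 2 = r ^+ 2 -> 0 <= t <= 1 ->
  forall c1 c2 C x, c1 = (e1 + 2 * xi - 1) / (2 * (1 - xi)) ->
  c2 = e2 / (2 * (1 - xi)) -> C = (r + a) / (2 * r) -> x = cay (r * t) ->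
  (4 * (1 - xi))^-1 * (C * (1 - x ^+ 2) * jfun (2 * xi) C x / den C x) <=
  req a b c1 c2 t - base0 xi (r * t).
Proof.
move=> /andP[xi0 xi1] e12 /andP[r0 r1] abr /andP[t0 t1].
move=> c1 c2 C x c1E c2E CE' xE.
have ab1 : a ^+ 2 + b ^+ 2 < 1 by rewrite abr expr_lt1// ltW.
have D0 : 0 < sqd a b t by apply: sqd_gt0 => //; rewrite t0.
pose s := r * t.
have s0 : 0 <= s by rewrite mulr_ge0// ltW.
set D := sqd a b t in D0.
have DE : D = 1 - 2 * (t * a) + s ^+ 2.
  have -> : s ^+ 2 = t ^+ 2 * (a ^+ 2 + b ^+ 2) by rewrite abr /s; ring.
  by rewrite /D /sqd; ring.
have X : 0 < 1 - xi by lra.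
have denE : den C x = D / (1 + s) ^+ 2.
  rewrite DE /den CE' xE /cay -/s /s; field.
  by rewrite !lt0r_neq0//; rewrite -/s; lra.
have CE : C * (1 - x ^+ 2) = 1 - D / (1 + s) ^+ 2 by rewrite -denE /den; ring.
set U := reu a b t; set V := imu a b t.
have UV : U ^+ 2 + V ^+ 2 = D^-1.
  by rewrite /U /V /reu /imu -/D /D /sqd; field; rewrite lt0r_neq0.
have UE : U = (D + 1 - s ^+ 2) / (2 * D).
  rewrite /U /reu -/D.
  have -> : t * a = (1 + s ^+ 2 - D) / 2 by rewrite DE; field.
  by field; rewrite lt0r_neq0.
have V2 : V ^+ 2 = D^-1 - U ^+ 2 by rewrite -UV; ring.
(* These are the parts of [u^2 - u = w u^2] with [w = t z], whose modulus is [s / D]; [epsilon]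
   enters only through [Re (epsilon (u^2 - u)) = e1 p - e2 q]. *)
pose p := U ^+ 2 - V ^+ 2 - U; pose q := 2 * U * V - V.
have pq : p ^+ 2 + q ^+ 2 = (s / D) ^+ 2.
  have -> : p ^+ 2 + q ^+ 2 = (U ^+ 2 + V ^+ 2) * (U ^+ 2 + V ^+ 2 - 2 * U + 1).
    by rewrite /p /q; ring.
  by rewrite UV UE; field; rewrite lt0r_neq0.
have epq : - (s / D) <= e1 * p - e2 * q.
  have : (e1 * p - e2 * q) ^+ 2 <= (s / D) ^+ 2.
    rewrite -pq -[leRHS]mul1r -e12 -subr_ge0.
    have -> : (e1 ^+ 2 + e2 ^+ 2) * (p ^+ 2 + q ^+ 2) - (e1 * p - e2 * q) ^+ 2 =
      (e1 * q + e2 * p) ^+ 2 by ring.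
    exact: sqr_ge0.
  have : 0 <= s / D by apply: divr_ge0 => //; exact: ltW.
  by move: (s / D) (e1 * p - e2 * q) => k m k0 mk; nra.
have -> : req a b c1 c2 t = (2 * (1 - xi))^-1 *
    (U ^+ 2 - V ^+ 2 + (1 - 2 * xi) * U + (e1 * p - e2 * q)).
  rewrite /req -/U -/V c1E c2E /p /q; field.
  by rewrite lt0r_neq0.
apply: (@le_trans _ _ ((2 * (1 - xi))^-1 *
    (U ^+ 2 - V ^+ 2 + (1 - 2 * xi) * U - s / D) - base0 xi s)); last first.
  by rewrite lerD2r ler_wpM2l ?invr_ge0//; lra.
(* With the worst [epsilon] inserted, the bound is an equality of rational functions in [D], [s] and
   [xi]. *)
rewrite V2 UE /jfun denE CE xE /cay -/s /base0 le_eqVlt; apply/orP; left.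
apply/eqP; field.
by rewrite !lt0r_neq0//; lra.
Qed.

Lemma coef_parts xi e1 e2 : xi < 1 ->
  coef xi (e1 +i* e2) =
  ((e1 + 2 * xi - 1) / (2 * (1 - xi))) +i* (e2 / (2 * (1 - xi))).
Proof.
move=> xi1; have X : 0 < 1 - xi by lra.
have N : 2 * (1 - xi%:C) = (2 * (1 - xi))%:C.
  by apply/eqP; rewrite eq_complex /=; apply/andP; split; apply/eqP; ring.
have X0 : (2 * (1 - xi))%:C != 0 by rewrite eq_complex /= eqxx andbT lt0r_neq0//; lra.
apply: (mulIf X0); rewrite /coef N divfK//.
apply/eqP; rewrite eq_complex /=; apply/andP; split; apply/eqP; field;
  by rewrite lt0r_neq0.
Qed.

Definition dbase0 xi t := (xi * (1 + t) - 2) / ((1 - xi) * (1 + t) ^+ 3).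

Lemma der_base0 xi t : xi < 1 -> 0 <= t -> is_derive t 1 (base0 xi) (dbase0 xi t).
Proof.
move=> xi1 t0; have X : 0 < 1 - xi by lra.
have T : 0 < 1 + t by lra.
der_eq.
  by rewrite /base0; der; rewrite lt0r_neq0// mulr_gt0 ?exprn_gt0.
by rewrite /dbase0 /=; field; rewrite !lt0r_neq0.
Qed.

(** [base1] is the derivative of [t * base0 xi t], just as [Re h'(t z)] is that of
    [t Re (h (t z) / (t z))]; hence the form [G + t G' / delta] of [hdz]. *)
Lemma base1E xi t : xi < 1 -> 0 <= t ->
  base1 xi t = base0 xi t + t * dbase0 xi t.
Proof.
move=> xi1 t0; have X : 0 < 1 - xi by lra.
have T : 0 < 1 + t by lra.
by rewrite /base0 /base1 /dbase0; field; rewrite !lt0r_neq0.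
Qed.

Lemma normc_lt1 (a b : R) : `|a +i* b| < 1 -> a ^+ 2 + b ^+ 2 < 1.
Proof.
rewrite normc_def /= -[1]/((1 : R)%:C) ltcR => H.
rewrite ltNge; apply/negP => ge1; move: H; apply/negP; rewrite -leNgt.
by rewrite -sqrtr1 ler_sqrt ?addr_ge0 ?sqr_ge0.
Qed.

Lemma normc_eq1 (a b : R) : `|a +i* b| = 1 -> a ^+ 2 + b ^+ 2 = 1.
Proof.
rewrite normc_def /= => -[H].
by rewrite -[LHS]sqr_sqrtr ?addr_ge0 ?sqr_ge0// H expr1n.
Qed.

Lemma hdz_data delta xi epsilon z : 0 < delta -> 0 <= xi <= 2^-1 ->
  `|z| < 1 -> `|epsilon| = 1 ->
  exists (G dG : R -> R) (r C : R), [/\ 0 < r < 1 /\ 0 <= C <= 1,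
    forall t, 0 <= t <= 1 ->
      is_derive t 1 G (dG t) /\ {for t, continuous dG},
    forall t, 0 <= t <= 1 ->
      hdz delta xi (hxi xi epsilon) z t = G t + delta^-1 * (t * dG t),
    forall t, 0 <= t <= 1 -> (4 * (1 - xi))^-1 *
      (C * (1 - cay (r * t) ^+ 2) * jfun (2 * xi) C (cay (r * t))
       / den C (cay (r * t))) <= G t &
    G 0 = 0].
Proof.
case: z => a b; case: epsilon => e1 e2 d0 xi01 /normc_lt1 ab1 /normc_eq1 e12.
have /andP[xi0 xi1] := xi01.
have xilt1 : xi < 1 by lra.
pose c1 := (e1 + 2 * xi - 1) / (2 * (1 - xi)).
pose c2 := e2 / (2 * (1 - xi)).
pose G t := req a b c1 c2 t - base0 xi t.
pose dG t := dreq a b c1 c2 t - dbase0 xi t.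
have D t : 0 <= t <= 1 -> sqd a b t != 0.
  by move=> t01; rewrite lt0r_neq0// sqd_gt0.
have dGP t : 0 <= t <= 1 -> is_derive t 1 G (dG t) /\ {for t, continuous dG}.
  move=> t01; have /andP[t0 t1] := t01; have Dt := D _ t01.
  have T : 0 < (1 - xi) * (1 + t) ^+ 3.
    by rewrite mulr_gt0 ?exprn_gt0//; lra.
  split.
    notypeclasses refine (der_add _ (der_opp _)); first exact: der_req.
    exact: der_base0.
  notypeclasses refine (der_continuous _).
  rewrite /dG /dreq /dreu /dimu /reu /imu /sqd /dbase0; der.
  all: rewrite ?expf_neq0//.
  exact: lt0r_neq0.
have hE t : 0 <= t <= 1 ->
    hdz delta xi (hxi xi (e1 +i* e2)) (a +i* b) t = G t + delta^-1 * (t * dG t).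
  move=> t01; have /andP[t0 t1] := t01; have Dt := D _ t01.
  have w1 : t%:C * (a +i* b) != 1.
    apply/negP; rewrite eq_complex /= !mul0r subr0 addr0 => /andP[/eqP Ea /eqP Eb].
    by move: Dt; rewrite /sqd Ea Eb subrr !expr0n addr0 eqxx.
  rewrite /hdz quot0_hxi// cderive_hxi// coef_parts// -/c1 -/c2.
  rewrite req_parts// dreq_parts// base1E// /G /dG; field.
  exact: lt0r_neq0.
have G0 : G 0 = 0.
  rewrite /G /req /reu /imu /sqd /base0; field.
  by rewrite !lt0r_neq0//; lra.
have [r0|r0] := eqVneq (a ^+ 2 + b ^+ 2) 0.
  have /andP[/eqP a0 /eqP b0] : (a == 0) && (b == 0).
    by rewrite -(sqrf_eq0 a) -(sqrf_eq0 b) -paddr_eq0 ?sqr_ge0// r0.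
  (* At [z = 0] the ratio [Re z / r] has no meaning. Any [r] serves with [C = 0], for which the
     lower bound is 0. *)
  exists G, dG, 2^-1, 0; split => //.
    by split; lra.
  move=> t t01; have /andP[t0 t1] := t01.
  rewrite !mul0r mulr0 /G.
  have -> : req a b c1 c2 t = base0 xi 0.
    rewrite /req /reu /imu /sqd /base0 a0 b0; field.
    by rewrite !lt0r_neq0//; lra.
  by rewrite subr_ge0 base0_le.
have rp : 0 < a ^+ 2 + b ^+ 2 by rewrite lt_neqAle eq_sym r0 addr_ge0 ?sqr_ge0.
pose r := Num.sqrt (a ^+ 2 + b ^+ 2).
have rr : a ^+ 2 + b ^+ 2 = r ^+ 2 by rewrite sqr_sqrtr// ltW.
have r_gt0 : 0 < r by rewrite sqrtr_gt0.
have r_lt1 : r < 1 by rewrite -sqrtr1 ltr_sqrt.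
have ar : - r <= a <= r.
  rewrite -ler_norml -(ler_pXn2r (_ : 0 < 2)%N) ?nnegrE ?(ltW r_gt0)//.
  by rewrite real_normK ?num_real// -rr lerDl sqr_ge0.
have /andP[ar1 ar2] := ar.
exists G, dG, r, ((r + a) / (2 * r)); split => //.
  split; first by rewrite r_gt0.
  rewrite divr_ge0 ?ler_pdivrMr ?mul1r//; lra.
move=> t t01; have /andP[t0 t1] := t01.
apply: (@le_trans _ _ (req a b c1 c2 t - base0 xi (r * t))).
  by apply: (req_lower _ e12) => //; rewrite r_gt0.
rewrite lerD2l lerN2 base0_le//; first by rewrite mulr_ge0// ltW.
by rewrite ler_piMl// ltW.
Qed.

End Complex.

(** * Integrals with a variable lower end *)

Section Integrals.
Context {R : realType}.
Local Notation leb := (@lebesgue_measure R).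
Implicit Types (f g h : R -> R) (a b x y p : R).

Lemma within_itv_bounded h a b : {within `[a, b], continuous h} ->
  [bounded h x | x in `[a, b]].
Proof.
move=> ch.
have /compact_bounded[M [_ mrt]] := continuous_compact ch (@segment_compact _ a b).
by exists M; split; rewrite ?num_real // => ? ? ? ?; exact: mrt.
Qed.

Lemma integrable_mul_continuous g h a b :
  leb.-integrable `[a, b] (EFin \o g) -> {within `[a, b], continuous h} ->
  leb.-integrable `[a, b] (EFin \o (fun s => g s * h s)).
Proof.
move=> ig ch; have mh : measurable_fun `[a, b] h.
  exact: subspace_continuous_measurable_fun.
exact: (integrableMl _ ig mh (within_itv_bounded ch)).
Qed.

Lemma der_integral f a x b : a < x < b ->
  leb.-integrable `[a, b] (EFin \o f) -> {for x, continuous f} ->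
  is_derive x 1 (fun y => \int[leb]_(t in `[a, y]) f t) (f x).
Proof.
move=> /andP[ax xb] fi cf.
have [d1 d2] := continuous_FTC1_closed xb fi ax cf.
by apply: DeriveDef => //; rewrite -derive1E.
Qed.

Lemma Rintegral_tail f a x b : a <= x <= b ->
  leb.-integrable `[a, b] (EFin \o f) ->
  \int[leb]_(t in `[x, b]) f t =
  \int[leb]_(t in `[a, b]) f t - \int[leb]_(t in `[a, x]) f t.
Proof.
move=> /andP[ax xb] fi.
rewrite (@Rintegral_itvB R f (BLeft a) (BRight b) x)// ?bnd_simp//.
rewrite Rintegral_itv_obnd_cbnd//.
by apply: integrableS fi => //; apply: subset_itvScc => //.
Qed.

Lemma near_itv_oo a b x : a < x < b -> \forall y \near x, a <= y <= b.
Proof.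
move=> axb; have : x \in `]a, b[ by [].
move=> /near_in_itvoo; apply: filterS => y; rewrite in_itv/= => /andP[? ?].
by rewrite !ltW.
Qed.

Lemma continuous_tail f a x b : a < x < b ->
  leb.-integrable `[a, b] (EFin \o f) ->
  {for x, continuous (fun y => \int[leb]_(t in `[y, b]) f t)}.
Proof.
move=> axb fi; have /andP[ax xb] := axb.
have ab : a < b by exact: lt_trans xb.
have /(continuous_within_itvP _ ab)[c1 _ _] :=
  parameterized_integral_continuous (ltW ab) fi.
suff : \int[leb]_(t in `[y, b]) f t @[y --> x] -->
    \int[leb]_(t in `[x, b]) f t by [].
rewrite (Rintegral_tail _ fi); last by rewrite !ltW.
apply: cvg_trans (_ : (_ - \int[leb]_(t in `[a, y]) f t) @[y --> x] --> _).
  apply: near_eq_cvg; near=> y.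
  by rewrite (Rintegral_tail _ fi)//; near: y; exact: near_itv_oo.
by apply: cvgB; [exact: cvg_cst|apply: c1].
Unshelve. all: by end_near. Qed.

Lemma cvg_at_left_tail f a b : a < b ->
  leb.-integrable `[a, b] (EFin \o f) ->
  \int[leb]_(t in `[y, b]) f t @[y --> b^'-] --> 0.
Proof.
move=> ab fi.
have /(continuous_within_itvP _ ab)[_ _ c1] :=
  parameterized_integral_continuous (ltW ab) fi.
rewrite -[X in _ --> X](subrr (\int[leb]_(t in `[a, b]) f t)).
apply: cvg_trans (_ : (_ - \int[leb]_(t in `[a, y]) f t) @[y --> b^'-] --> _).
  apply: near_eq_cvg; near=> y.
  rewrite (Rintegral_tail _ fi)//; apply/andP; split; near: y.
    exact: nbhs_left_ge.
  exact: nbhs_left_le.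
by apply: cvgB; [exact: cvg_cst|apply: c1].
Unshelve. all: by end_near. Qed.

Lemma der_tail f a x b : a < x < b ->
  leb.-integrable `[a, b] (EFin \o f) -> {for x, continuous f} ->
  is_derive x 1 (fun y => \int[leb]_(t in `[y, b]) f t) (- f x).
Proof.
move=> axb fi cf.
notypeclasses refine (@near_eq_is_derive _ _ _
  (fun y => \int[leb]_(t in `[a, b]) f t - \int[leb]_(t in `[a, y]) f t) _ _ _ _ _ _).
  have := near_itv_oo axb; apply: filterS => y aybb.
  by rewrite (Rintegral_tail aybb fi).
rewrite -[- f x]add0r.
notypeclasses refine (der_add (der_cst _ _) (der_opp _)).
exact: (der_integral axb fi cf).
Qed.

Section Weights.
Variables (delta mu nu : R) (lambda : R -> R).
Hypothesis lambda_int : leb.-integrable `[0, 1] (EFin \o lambda).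
Hypothesis Lambda_int : leb.-integrable `[0, 1] (EFin \o Lambda lambda delta nu).

Lemma continuous_powR p x : 0 < x -> {for x, continuous (fun s : R => s `^ p)}.
Proof.
by move=> x0; notypeclasses refine (der_continuous _); exact: is_derive1_powR.
Qed.

(** The power may be singular at 0, so one stays on [[a, 1]]; near a given [x] the choice
    [a = x / 2] is enough. *)
Lemma integrable_mul_powR g a p : 0 < a < 1 ->
  leb.-integrable `[0, 1] (EFin \o g) ->
  leb.-integrable `[a, 1] (EFin \o (fun s => g s * s `^ p)).
Proof.
move=> /andP[a0 a1] gi; apply: integrable_mul_continuous.
  by apply: integrableS gi => //; apply: subset_itvScc => //; exact: ltW.
apply: continuous_in_subspaceT => s; rewrite inE/= in_itv/= => /andP[as_ _].
by apply: continuous_powR; exact: lt_le_trans as_.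
Qed.

Lemma continuous_Lambda x : 0 < x < 1 ->
  {for x, continuous (Lambda lambda delta nu)}.
Proof.
move=> /andP[x0 x1]; apply: (@continuous_tail _ (x / 2)); first by lra.
by apply: integrable_mul_powR => //; lra.
Qed.

Lemma der_Pi x : 0 < x < 1 -> is_derive x 1 (Pi lambda delta mu nu)
  (- (Lambda lambda delta nu x * x `^ (- (delta / mu - delta / nu + 1)))).
Proof.
move=> x01; have /andP[x0 x1] := x01.
apply: (@der_tail _ (x / 2)); first by lra.
  by apply: integrable_mul_powR => //; lra.
apply: continuousM; first exact: continuous_Lambda.
exact: continuous_powR.
Qed.

Lemma Pi_cvg1 : Pi lambda delta mu nu y @[y --> 1^'-] --> 0.
Proof.
apply: (@cvg_at_left_tail _ (1 / 2)); first by lra.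
by apply: integrable_mul_powR => //; lra.
Qed.

End Weights.

End Integrals.

(** * Positivity of the operator *)

Section Positivity.
Context {R : realType}.
Local Notation leb := (@lebesgue_measure R).
Implicit Types (s t x : R).
Variables (delta mu xi : R) (P dP : R -> R).
Hypotheses (delta1 : 1 <= delta) (mu01 : 2^-1 <= mu <= 1).
Hypothesis xi01 : 0 <= xi <= 2^-1.
Hypothesis P_int : leb.-integrable `[0, 1] (EFin \o P).
Hypothesis P_gt0 : forall t, 0 < t < 1 -> 0 < P t.
Hypothesis der_P : forall t, 0 < t < 1 -> is_derive t 1 P (dP t).
Hypothesis dP_le0 : forall t, 0 < t < 1 -> dP t <= 0.
Hypothesis P_cvg1 : P t @[t --> 1^'-] --> 0.

(** With [k = delta (1/mu - 1)], this is [- t^(1 - k)] times the derivative of [t^k P t]. *)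
Let B t := delta * (1 - mu^-1) * P t - t * dP t.
Let phi t := t `^ (mu^-1 * (delta - 1)) * B t / ln (1 / t) `^ (1 + 2 * xi).
Hypothesis phi_le : forall s t, 0 < s -> s <= t -> t < 1 -> phi t <= phi s.

Let mu_gt0 : 0 < mu. Proof. by case/andP : mu01 => ? _; lra. Qed.

Let ln_gt0 t : 0 < t < 1 -> 0 < ln (1 / t).
Proof. by move=> /andP[t0 t1]; rewrite ln_gt0// div1r invf_gt1. Qed.

Let P_le s t : 0 < s -> s <= t -> t < 1 -> P t <= P s.
Proof.
move=> s0 st t1; rewrite -lerN2.
apply: (@ge0_der_le _ (fun t => - P t) (fun t => - dP t)) => // x /andP[sx xt].
  by notypeclasses refine (der_opp _); apply: der_P; lra.
by rewrite oppr_ge0; apply: dP_le0; lra.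
Qed.

(* A negative value of [phi] would persist up to [1], making
   [t^(delta (1/mu - 1)) P t] increasing there, against [P t --> 0]. *)
Let phi_ge0 t : 0 < t < 1 -> 0 <= phi t.
Proof.
move=> t01; have /andP[t0 t1] := t01; rewrite leNgt; apply/negP => phit.
pose k := delta * (mu^-1 - 1).
have k0 : 0 <= k.
  apply: mulr_ge0; first exact: le_trans ler01 delta1.
  by rewrite subr_ge0 invf_ge1//; case/andP : mu01.
have B0 s : t <= s < 1 -> B s <= 0.
  move=> /andP[ts s1]; have s01 : 0 < s < 1 by lra.
  have s0 : 0 < s by lra.
  have : phi s < 0 by apply: le_lt_trans phit; exact: phi_le.
  rewrite /phi pmulr_llt0 ?invr_gt0 ?powR_gt0 ?ln_gt0//.
  by rewrite pmulr_rlt0 ?powR_gt0//; exact: ltW.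
have K s : t <= s < 1 -> t `^ k * P t <= P s.
  move=> /andP[ts s1]; apply: (@le_trans _ _ (s `^ k * P s)).
    apply: (@ge0_der_le _ (fun s => s `^ k * P s)
      (fun s => - (s `^ k / s) * B s)) => // x /andP[tx xs].
      have x01 : 0 < x < 1 by lra.
      der_eq.
        notypeclasses refine (der_mul (der_powR _ _ (der_id _)) (der_P x01)).
        by lra.
      rewrite /B /k /=; field.
      by rewrite !lt0r_neq0//; lra.
    rewrite mulNr oppr_ge0; apply: mulr_ge0_le0; last by apply: B0; lra.
    by rewrite divr_ge0 ?powR_ge0//; lra.
  apply: ler_piMl; first by apply/ltW/P_gt0; lra.
  have -> : 1 = 1 `^ k :> R by rewrite powR1.
  by apply: ge0_ler_powR; rewrite ?nnegrE//; lra.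
have c0 : 0 < t `^ k * P t by rewrite mulr_gt0 ?powR_gt0 ?P_gt0.
have near1 : \forall s \near 1^'-, P s < t `^ k * P t.
  exact: (@cvgr_lt _ _ _ _ P 0 P_cvg1).
have near2 : \forall s \near 1^'-, P s < t `^ k * P t /\ t <= s < 1.
  near=> s; split; first by near: s.
  by apply/andP; split; near: s; [exact: nbhs_left_ge|exact: nbhs_left_lt].
have [|s [Ps ts1]] := filter_ex near2; first exact: at_left_proper_filter.
by move: Ps; apply/negP; rewrite -leNgt K.
Unshelve. all: by end_near. Qed.

(** [P] is nonincreasing but may be unbounded at 0; integrability then still makes [t P t] vanish
    there. *)
Let mulP_le t : 0 < t < 1 -> t * P t <= \int[leb]_(s in `[0, t]) P s.
Proof.
move=> t01; have /andP[t0 t1] := t01.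
have sub : [set` `]0, t]] `<=` [set` `[(0 : R), 1]].
  by move=> x /=; rewrite !in_itv/= => /andP[? ?]; apply/andP; split; lra.
have P_intD : leb.-integrable `]0, t] (EFin \o P) by exact: integrableS P_int.
rewrite -Rintegral_itv_obnd_cbnd//.
have -> : t * P t = \int[leb]_(s in `]0, t]) (fun=> P t) s.
  have mD : leb [set` `]0, t]] = t%:E.
    by rewrite lebesgue_measure_itv/= lte_fin t0 -EFinB subr0.
  rewrite Rintegral_cst// mulrC; congr (_ * _).
  by rewrite -[LHS]/(fine t%:E) -mD.
have cst_int : leb.-integrable `]0, t] (EFin \o (fun=> P t)).
  have : leb.-integrable `[0, 1] (EFin \o (fun=> P t)).
    apply: continuous_compact_integrable; first exact: segment_compact.
    by apply: continuous_subspaceT => x; exact: cvg_cst.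
  by apply: integrableS.
apply: le_Rintegral => //.
by move=> x; rewrite /= in_itv/= => /andP[x0 xt]; exact: P_le.
Qed.

Section Fixed.
Variables (G dG : R -> R).
Hypothesis G_der : forall t, 0 <= t <= 1 ->
  is_derive t 1 G (dG t) /\ {for t, continuous dG}.
Hypothesis G0 : G 0 = 0.
Variables (r C : R).
Hypotheses (r01 : 0 < r < 1) (C01 : 0 <= C <= 1).
Hypothesis G_ge : forall t, 0 <= t <= 1 -> (4 * (1 - xi))^-1 *
  (C * (1 - cay (r * t) ^+ 2) * jfun (2 * xi) C (cay (r * t))
   / den C (cay (r * t))) <= G t.

Let f t := t `^ (delta / mu - 1) * P t * (G t + delta^-1 * (t * dG t)).
Let bdry t := delta^-1 * (t `^ (delta / mu) * P t * G t).
Let prim t := \int[leb]_(s in `[0, t]) f s.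

Let exp_ge0 : 0 <= delta / mu - 1.
Proof.
rewrite subr_ge0 ler_pdivlMr// mul1r; apply: le_trans delta1.
by case/andP : mu01.
Qed.

Let cG t : 0 <= t <= 1 ->
  {for t, continuous (fun t => G t + delta^-1 * (t * dG t))}.
Proof.
move=> t01; have [dGt cdG] := G_der t01.
apply: (@continuousD _ _ _ G); first exact: der_continuous dGt.
apply: (@continuousM _ _ (fun=> delta^-1)); first exact: cst_continuous.
by apply: (@continuousM _ _ id).
Qed.

Let f_int : leb.-integrable `[0, 1] (EFin \o f).
Proof.
pose h t := P t * (G t + delta^-1 * (t * dG t)).
pose w t := t `^ (delta / mu - 1).
have H : leb.-integrable `[0, 1] (EFin \o h).
  apply: integrable_mul_continuous => //.
  apply: continuous_in_subspaceT => t; rewrite inE/= in_itv/= => t01.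
  exact: cG.
have mp : measurable_fun ([set` `[(0 : R), 1]] : set R) w.
  apply: measurable_funTS; exact: measurable_powR.
have bp : [bounded w t | t in `[(0 : R), 1]].
  exists 1; split; first exact: num_real.
  move=> M M1 t /=; rewrite in_itv/= => /andP[t0 t1].
  rewrite /w ger0_norm ?powR_ge0//; apply: le_trans (ltW M1).
  have := @ge0_ler_powR R _ exp_ge0 t 1; rewrite powR1.
  by apply; rewrite ?nnegrE.
have -> : EFin \o f = ((EFin \o h) \* (EFin \o w))%E.
  by apply/funext => t /=; rewrite -EFinM /f /h /w; congr EFin; ring.
exact: (integrableMl _ H mp bp).
Qed.

Let der_prim t : 0 < t < 1 -> is_derive t 1 prim (f t).
Proof.
move=> t01; have /andP[t0 t1] := t01.
apply: (der_integral t01 f_int).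
rewrite /f; apply: continuousM; last by apply: cG; rewrite !ltW.
apply: continuousM; first exact: continuous_powR.
exact: der_continuous (der_P t01).
Qed.

(** Integration by parts in differential form: trading [t G' / delta] for [G] turns the factor [P]
    into [B / delta]. *)
Let der_bdry t : 0 < t < 1 -> is_derive t 1 bdry
  (f t - delta^-1 * (t `^ (delta / mu - 1) * B t * G t)).
Proof.
move=> t01; have /andP[t0 t1] := t01.
have [dGt _] : is_derive t 1 G (dG t) /\ {for t, continuous dG}.
  by apply: G_der; rewrite !ltW.
have d0 : 0 < delta by exact: lt_le_trans delta1.
der_eq.
  notypeclasses refine (der_mul (der_cst _ _)
    (der_mul (der_mul (der_powR _ _ (der_id _)) (der_P t01)) dGt)).
  exact: t0.
have -> : t `^ (delta / mu) = t `^ (delta / mu - 1) * t.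
  rewrite -{3}[t]powRr1 ?(ltW t0)// -powRD ?subrK//.
  by rewrite (gt_eqF t0) implybT.
rewrite /f /B /=; field.
by rewrite !lt0r_neq0.
Qed.

Let bdry_cvg0 : bdry t @[t --> 0^'+] --> 0.
Proof.
have Gcvg : G t @[t --> 0^'+] --> 0.
  have [dG0 _] : is_derive (0 : R) 1 G (dG 0) /\ {for 0, continuous dG}.
    by apply: G_der; rewrite lexx ler01.
  rewrite -[X in _ --> X]G0; apply: cvg_at_right_filter.
  exact: (der_continuous dG0).
rewrite -[X in _ --> X](mulr0 delta^-1); apply: cvgMr.
rewrite -[X in _ --> X](mul0r 0); apply: cvgM => //.
(* Since [delta / mu >= 1], the power is at most [t], and [mulP_le] applies. *)
apply: (@squeeze_cvgr _ _ _ _ (fun=> 0) (fun t => \int[leb]_(s in `[0, t]) P s)).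
- near=> t; have t01 : 0 < t < 1.
    by apply/andP; split; near: t; [exact: nbhs_right_gt|exact: nbhs_right_lt].
  have /andP[t0 t1] := t01.
  rewrite mulr_ge0 ?powR_ge0 ?(ltW (P_gt0 _))//=.
  apply: le_trans (mulP_le t01); rewrite ler_wpM2r ?(ltW (P_gt0 _))//.
  rewrite -[leRHS]powRr1 ?(ltW t0)// ger_powR ?t0 ?(ltW t1)//.
  by rewrite -subr_ge0.
- exact: cvg_cst.
- exact/cvg_at_right_filter/parameterized_integral_cvg_left/P_int.
Unshelve. all: by end_near. Qed.

Let bdry_cvg1 : bdry t @[t --> 1^'-] --> 0.
Proof.
have [dG1 _] : is_derive (1 : R) 1 G (dG 1) /\ {for 1, continuous dG}.
  by apply: G_der; rewrite lexx ler01.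
rewrite -[X in _ --> X](mulr0 delta^-1); apply: cvgMr.
rewrite -[X in _ --> X](mul0r (G 1)); apply: cvgM; last first.
  by apply: cvg_at_left_filter; exact: (der_continuous dG1).
rewrite -[X in _ --> X](mulr0 (1 `^ (delta / mu))); apply: cvgM => //.
by apply: cvg_at_left_filter; exact: continuous_powR.
Qed.

(** The exponent splits as [(delta - 1) / mu + (1/mu - 1)]: the first part belongs to [phi], the
    second is the [a] of [weighted_minorant]. *)
Let powR_B t : 0 < t < 1 -> t `^ (delta / mu - 1) * B t =
  t `^ (mu^-1 - 1) * phi t * ln (1 / t) `^ (1 + 2 * xi).
Proof.
move=> t01; have /andP[t0 t1] := t01.
have L0 : 0 < ln (1 / t) `^ (1 + 2 * xi) by rewrite powR_gt0 ?ln_gt0.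
rewrite -mulrA /phi divfK ?lt0r_neq0// mulrA -powRD ?(gt_eqF t0) ?implybT//.
by congr (_ `^ _ * _); field; rewrite lt0r_neq0.
Qed.

Lemma Rintegral_kernel_ge0 :
  0 <= \int[leb]_(t in `[0, 1])
         (t `^ (delta / mu - 1) * P t * (G t + delta^-1 * (t * dG t))).
Proof.
have d0 : 0 < delta by exact: lt_le_trans delta1.
have tau01 : 0 <= 2 * xi <= 1 by move: xi01; lra.
have a01 : 0 <= mu^-1 - 1 <= 1.
  have mu_ge1 : 1 <= mu^-1 by rewrite invf_ge1//; case/andP : mu01.
  have mu_le2 : mu^-1 <= 2 by rewrite invf_ple ?posrE//; case/andP : mu01.
  by apply/andP; split; [rewrite subr_ge0|rewrite lerBlDr].
have [q [dq [b [b01 q_der dq_le q_ge0 q_cvg]]]] :=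
  weighted_minorant tau01 C01 r01 a01 phi_ge0 phi_le.
pose c := delta^-1 * (4 * (1 - xi))^-1.
have kap0 : 0 < (4 * (1 - xi))^-1.
  by rewrite invr_gt0 mulr_gt0// subr_gt0; case/andP : xi01 => _ ?; lra.
(* [Psi] is nondecreasing and tends to 0 at 0, hence is nonnegative. Near 1, where [q] is
   nonnegative and [bdry] vanishes in the limit, this passes to [prim 1]. *)
pose Psi t := prim t - bdry t - c * q t.
have Psi_le s t : 0 < s -> s <= t -> t < 1 -> Psi s <= Psi t.
  move=> s0 st t1; apply: (@ge0_der_le _ Psi (fun t =>
    f t - (f t - delta^-1 * (t `^ (delta / mu - 1) * B t * G t)) - c * dq t))
    => // x /andP[sx xt]; have x01 : 0 < x < 1 by lra.
    notypeclasses refine (der_add (der_add (der_prim x01) (der_opp (der_bdry x01)))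
      (der_opp _)).
    der_eq; first by notypeclasses refine (der_mul (der_cst _ _) (q_der _ x01)).
    by rewrite mul0r add0r.
  have x01' : 0 <= x <= 1 by lra.
  rewrite opprB addrCA subrr addr0 powR_B// subr_ge0 /c -mulrA.
  rewrite ler_wpM2l ?invr_ge0 ?(ltW d0)//.
  apply: le_trans (ler_wpM2l (ltW kap0) (dq_le _ x01)) _.
  rewrite mulrCA; apply: ler_wpM2l; last exact: G_ge.
  apply: mulr_ge0; last exact: powR_ge0.
  by apply: mulr_ge0; [exact: powR_ge0|exact: phi_ge0].
have /(continuous_within_itvP _ (@ltr01 R))[_ prim0 prim1] :=
  parameterized_integral_continuous ler01 f_int.
have Psi_cvg : Psi t @[t --> 0^'+] --> 0.
  have E0 : prim 0 - 0 - c * 0 = 0.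
    by rewrite /prim set_itv1 Rintegral_set1; ring.
  rewrite -[X in _ --> X]E0.
  apply: cvgB; first exact: cvgB prim0 bdry_cvg0.
  by apply: cvgMr; exact: cvg_at_right_filter.
have Psi_ge0 t : 0 < t < 1 -> 0 <= Psi t.
  move=> /andP[t0 t1]; apply: (cvgr_to_le Psi_cvg).
  near=> s; apply: Psi_le => //; near: s.
  exact: nbhs_right_le.
have prim_cvg : prim t - bdry t @[t --> 1^'-] --> prim 1.
  by rewrite -[prim 1]subr0; exact: cvgB prim1 bdry_cvg1.
apply: (cvgr_to_ge prim_cvg); have /andP[b0 b1] := b01.
near=> t; have bt : b <= t < 1.
  by apply/andP; split; near: t; [exact: nbhs_left_ge|exact: nbhs_left_lt].
have t01 : 0 < t < 1 by lra.
apply: le_trans (Psi_ge0 _ t01) _; rewrite /Psi gerBl.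
by rewrite /c !mulr_ge0 ?invr_ge0 ?(ltW d0) ?q_ge0//; lra.
Unshelve. all: by end_near. Qed.

End Fixed.

Lemma Mop_hxi_ge0 z epsilon : `|z| < 1 -> `|epsilon| = 1 ->
  0 <= Mop delta mu xi P (hxi xi epsilon) z.
Proof.
move=> z1 eps1; have d0 : 0 < delta by exact: lt_le_trans delta1.
have [G [dG [r [C [[r01 C01] G_der hE G_ge G0]]]]] := hdz_data d0 xi01 z1 eps1.
suff -> : Mop delta mu xi P (hxi xi epsilon) z = \int[leb]_(t in `[0, 1])
    (t `^ (delta / mu - 1) * P t * (G t + delta^-1 * (t * dG t))).
  exact: (Rintegral_kernel_ge0 G_der G0 r01 C01 G_ge).
by apply: eq_Rintegral => t; rewrite inE/= in_itv/= => t01; rewrite hE.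
Qed.

End Positivity.

(** * Application to [Lambda] and [Pi] *)

Theorem theorem3p2 (R : realType)
  (delta zeta xi mu nu alpha gamma beta : R) (lambda q : R -> R)
  (hdelta : 1 <= delta)
  (hzeta : 1 - delta^-1 <= zeta <= 1 - (2 * delta)^-1)
  (hxi_def : xi = 1 - delta * (1 - zeta))
  (hmu : 2^-1 <= mu <= 1)
  (hnu : 1 <= nu)
  (hgamma : mu * nu = gamma)
  (halpha : mu + nu = alpha - gamma)
  (hlambda0 : forall t : R, 0 <= t <= 1 -> 0 <= lambda t)
  (hlambda_int :
     (@lebesgue_measure R).-integrable `[0, 1] (EFin \o lambda))
  (hlambda1 : \int[@lebesgue_measure R]_(t in `[0, 1]) lambda t = 1)
  (hLambda_pos : forall t : R, 0 < t < 1 -> 0 < Lambda lambda delta nu t)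
  (hLambda_int :
     (@lebesgue_measure R).-integrable `[0, 1]
       (EFin \o Lambda lambda delta nu))
  (hPi_pos : forall t : R, 0 < t < 1 -> 0 < Pi lambda delta mu nu t)
  (hPi_int :
     (@lebesgue_measure R).-integrable `[0, 1]
       (EFin \o Pi lambda delta mu nu))
  (hq : is_q delta mu nu xi q)
  (hbeta1 : beta < 1)
  (hbeta : (beta - 2^-1) / (1 - beta) =
           - \int[@lebesgue_measure R]_(t in `[0, 1]) (lambda t * q t))
  (hdecr :
     {in `]0, 1[ &, {homo (fun t : R =>
        t `^ (mu^-1 * (delta - 1)) *
        (delta * (1 - mu^-1) * Pi lambda delta mu nu t
         - t * derive1 (Pi lambda delta mu nu) t)
        / ln (1 / t) `^ (3 - 2 * delta * (1 - zeta))) : s t /~ s <= t}}) :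
  forall z epsilon : R[i], `|z| < 1 -> `|epsilon| = 1 ->
    0 <= Mop delta mu xi (Pi lambda delta mu nu) (hxi xi epsilon) z.
Proof.
have delta0 : 0 < delta by exact: lt_le_trans hdelta.
have xi01 : 0 <= xi <= 2^-1.
  have E1 : delta * delta^-1 = 1 by rewrite divff ?lt0r_neq0.
  have E2 : delta * (2 * delta)^-1 = 2^-1 by field; rewrite lt0r_neq0.
  case/andP : hzeta => h1 h2.
  have : delta * (1 - zeta) <= delta * delta^-1 by rewrite ler_wpM2l ?(ltW delta0)//; lra.
  have : delta * (2 * delta)^-1 <= delta * (1 - zeta).
    by rewrite ler_wpM2l ?(ltW delta0)//; lra.
  by rewrite E1 E2 hxi_def => ? ?; apply/andP; split; lra.
(* The logarithm thus carries the exponent [1 + tau] of the minorant, with [tau = 2 xi]. *)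
have pE : 3 - 2 * delta * (1 - zeta) = 1 + 2 * xi by rewrite hxi_def; ring.
rewrite pE in hdecr.
have Pi_der := der_Pi mu hlambda_int hLambda_int.
have Pi_derE t : 0 < t < 1 -> derive1 (Pi lambda delta mu nu) t =
    - (Lambda lambda delta nu t * t `^ (- (delta / mu - delta / nu + 1))).
  by move=> t01; rewrite derive1E; apply: derive_val; exact: Pi_der.
apply: (Mop_hxi_ge0 hdelta hmu xi01 hPi_int hPi_pos Pi_der).
- by move=> t t01; rewrite oppr_le0 mulr_ge0 ?powR_ge0 ?ltW ?hLambda_pos.
- exact: Pi_cvg1.
- move=> s t s0 st t1; have s01 : 0 < s < 1 by lra.
  have t01 : 0 < t < 1 by lra.
  by rewrite -!Pi_derE//; apply: hdecr => //; rewrite in_itv.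
Qed.
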